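(* Set $m_0=b_0$, $m_1=b_1$, and define inductively, for $n\ge 2$, $$D_n=-\frac12\sum_{i,j\ge 1,\ i+j=n}[m_i,m_j],\qquad m_n=\sigma(D_n).$$ Then $m_n=b_1^n/n!$ for all $n\geq 0$.
   Context: Graphs in the constant Poisson structure case. Let $k$ be a field of characteristic zero. For $m\ge 1$ consider directed graphs with $n\ge 0$ (unlabeled) internal vertices and $m$ boundary vertices labeled $1,\dots,m$; every internal vertex emits exactly two edges, labeled left and right, and boundary vertices emit none. Exchanging left and right at one internal vertex changes the sign of the graph (orientation classes). A graph in which both edges of an internal vertex have the same target is non-admissible and is set to zero; in the constant Poisson structure case a graph having an edge that lands on an internal vertex is also set to zero. Thus the space $C_m$ spanned by graphs with $m$ boundary vertices is the polynomial algebra $k[e_{pq}: 1\le p<q\le m]$, where $e_{pq}$ is the graph with one internal vertex whose left edge lands on $p$ and right edge on $q$, $e_{qp}=-e_{pq}$, $e_{pp}=0$, and the product superposes graphs with the same boundary vertices; the number $n$ of internal vertices is the polynomial degree. Put $b_0=1\in C_2$ (no internal vertices, two boundary vertices), $b_1=e_{12}\in C_2$, and $b_1^n=e_{12}^n\in C_2$ (so $b_1^0=b_0$). For $\Gamma_1\in C_{m_1}$, $\Gamma_2\in C_{m_2}$, the graph insertion $\Gamma_1\circ_i\Gamma_2\in C_{m_1+m_2-1}$ replaces the $i$-th boundary vertex of $\Gamma_1$ by $\Gamma_2$ (whose boundary vertices become $i,\dots,i+m_2-1$, the later boundary vertices of $\Gamma_1$ being shifted by $m_2-1$), and sums over all ways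 of landing each edge of $\Gamma_1$ that pointed to $i$ on one of the boundary vertices $i,\dots,i+m_2-1$. Then $\Gamma_1\circ\Gamma_2=\sum_{i=1}^{m_1}(-1)^{(i-1)(m_2-1)}\Gamma_1\circ_i\Gamma_2$ and $[\Gamma_1,\Gamma_2]=\Gamma_1\circ\Gamma_2-(-1)^{(m_1-1)(m_2-1)}\Gamma_2\circ\Gamma_1$; in particular for $m_1=m_2=2$ one has $\Gamma_1\circ\Gamma_2=\Gamma_1\circ_1\Gamma_2-\Gamma_1\circ_2\Gamma_2$ and $[\Gamma_1,\Gamma_2]=\Gamma_1\circ\Gamma_2+\Gamma_2\circ\Gamma_1$. The merger operation: for $1\le i\le m-1$, $\sigma_i(\Gamma)\in C_{m-1}$ is the graph obtained from $\Gamma\in C_m$ by merging the boundary vertices $i$ and $i+1$ (and relabeling in order), the result being zero if it is non-admissible. For a graph $\Gamma\in C_m$ with $n\ge 2$ internal vertices, $$\sigma(\Gamma)=\frac{1}{2(2^n-2)}\sum_{i=1}^{m-1}(-1)^{i-1}\sigma_i(\Gamma),$$ extended linearly. *)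

(* Defs.v *)
From HB Require Import structures.
From mathcomp Require Import all_boot all_order all_algebra.
From mathcomp Require Import finmap.
From mathcomp.multinomials Require Export monalg.

Set Implicit Arguments.
Unset Strict Implicit.
Unset Printing Implicit Defensive.

Import GRing.Theory.
Local Open Scope ring_scope.

(* Boundary vertices 1, ..., m are numbered from 0 here: they form 'I_m. *)

Record pairs (m : nat) : predArgType :=
  Pair { pair_val : 'I_m * 'I_m; _ : (pair_val.1 < pair_val.2)%N }.

HB.instance Definition _ m := [isSub for @pair_val m].
HB.instance Definition _ m := [Finite of pairs m by <:].

(* The polynomial algebra k[e_pq : p < q], as the monoid algebra of the free
   commutative monoid on the pairs p < q. *)
Notation C k m := {malg k[cmonom (pairs m)]}.

(* A graph all of whose edges land on boundary vertices: the list of its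
   internal vertices, each given by the targets of its (left, right) edges.
   The order of the list is forgotten by [graph_class]. *)
Definition graph (m : nat) : Type := seq ('I_m * 'I_m).

Section Operations.
Variable k : fieldType.

(* insub fails on (p, q) exactly when q <= p. *)
Definition e (m : nat) (p q : 'I_m) : C k m :=
  if insub (p, q) is Some x then << ucm (x : pairs m) >>
  else if insub (q, p) is Some x then - << ucm (x : pairs m) >>
  else 0.

Definition graph_class (m : nat) (g : graph m) : C k m :=
  \prod_(v <- g) e v.1 v.2.

(* The graph, with all edge pairs increasing, whose class is the monomial a. *)
Definition graph_of_monom (m : nat) (a : cmonom (pairs m)) : graph m :=
  [seq val x | x <- flatten [seq nseq (a x) x | x <- enum {: pairs m}]].

(* The linear extension of a function on graphs. It is computed on one
   representative graph per monomial, which loses nothing for an F that is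
   invariant under reordering the vertices, changes sign when the two edges of
   a vertex are exchanged and vanishes on graphs with a double edge. *)
Definition linext (m : nat) (V : lmodType k) (F : graph m -> V) (G : C k m) : V :=
  \sum_(a <- msupp G) G@_a *: F (graph_of_monom a).

Section Insertion.
Variables (m1 m2 : nat) (i : 'I_m1).

(* An edge of the first graph which pointed to t may land on u. *)
Definition lands (t : 'I_m1) (u : 'I_(m1 + m2).-1) : bool :=
  if (t < i)%N then u == t :> nat
  else if t == i then (i <= u < i + m2)%N
  else u.+1 == (t + m2)%N.

Lemma insert_vertex_subproof (j : 'I_m2) : (i + j < (m1 + m2).-1)%N.
Proof.
case: m1 i => [|n] [i' //=]; rewrite ltnS => le_in; have ltj := ltn_ord j.
by rewrite (leq_ltn_trans (leq_add le_in (leqnn _))) // ltn_add2l.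
Qed.

Definition insert_vertex (j : 'I_m2) : 'I_(m1 + m2).-1 :=
  Ordinal (insert_vertex_subproof j).

Definition graph_insert (g1 : graph m1) (g2 : graph m2) : C k (m1 + m2).-1 :=
  \sum_(h : (size g1).-tuple ('I_(m1 + m2).-1 * 'I_(m1 + m2).-1)
         | all2 (fun v w => lands v.1 w.1 && lands v.2 w.2) g1 h)
    graph_class (h ++ [seq (insert_vertex v.1, insert_vertex v.2) | v <- g2]).

Definition insert (G1 : C k m1) (G2 : C k m2) : C k (m1 + m2).-1 :=
  linext (fun g1 => linext (graph_insert g1) G2) G1.

End Insertion.

Definition circ (m1 m2 : nat) (G1 : C k m1) (G2 : C k m2) : C k (m1 + m2).-1 :=
  \sum_(i < m1) (-1) ^+ (i * m2.-1) *: insert i G1 G2.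

Definition castC (m m' : nat) (eq_m : m = m') (G : C k m) : C k m' :=
  ecast n (C k n) eq_m G.

Definition bracket (m1 m2 : nat) (G1 : C k m1) (G2 : C k m2) :
    C k (m1 + m2).-1 :=
  circ G1 G2 - (-1) ^+ (m1.-1 * m2.-1) *:
    castC (congr1 predn (addnC m2 m1)) (circ G2 G1).

Section Merger.
Variables (m : nat) (i : 'I_m.-1).

Lemma merge_vertex_subproof (t : 'I_m) : (unbump i t < m.-1)%N.
Proof.
rewrite /unbump; case: m i t => [|n] [i' /= lt_in] [t' //=].
rewrite ltnS leq_eqVlt => /predU1P[->|lt_tn].
  by rewrite lt_in subn1 ltn_predL (leq_ltn_trans _ lt_in).
exact: leq_ltn_trans (leq_subr _ _) lt_tn.
Qed.

(* t if t <= i, and t - 1 if t >= i + 1. *)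
Definition merge_vertex (t : 'I_m) : 'I_m.-1 :=
  Ordinal (merge_vertex_subproof t).

Definition graph_merge (g : graph m) : C k m.-1 :=
  graph_class [seq (merge_vertex v.1, merge_vertex v.2) | v <- g].

End Merger.

(* This operation is only meant for graphs with n = size g >= 2 internal
   vertices; the values in degrees 0 and 1 are junk. *)
Definition graph_sigma (m : nat) (g : graph m) : C k m.-1 :=
  (2 * (2 ^+ size g - 2))^-1 *:
    \sum_(i < m.-1) (-1) ^+ i *: graph_merge i g.

Definition sigma (m : nat) (G : C k m) : C k m.-1 := linext (@graph_sigma m) G.

Definition b0 : C k 2 := 1.

Definition b1 : C k 2 := e ord0 ord_max.

Definition D (M : nat -> C k 2) (n : nat) : C k 3 :=
  - 2^-1 *: \sum_(i < n.+1) \sum_(j < n.+1 | [&& 0 < i, 0 < j & i + j == n]%N)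
              bracket (M i) (M j).

End Operations.

(* Main.v *)
From HB Require Import structures.
Require Import Defs.
From mathcomp Require Import all_boot all_order all_algebra.
From mathcomp Require Import finmap ring.

Set Implicit Arguments.
Unset Strict Implicit.
Unset Printing Implicit Defensive.

Import GRing.Theory.
Local Open Scope ring_scope.

(** The mergers are algebra morphisms, and a composition is assembled from two
algebra morphisms, so the recursion can be computed on the generators e_pq.
Boundary vertices are numbered from 0 in this text, so that b = b1 = e_01.

Let f assign an element f (p, q) of a commutative algebra A to every pair of
boundary vertices.  The linear extension of the function sending a graph to the
product of f over its internal vertices is an algebra morphism from C k m to A
([graph_subst]), which sends e_pq to f (p, q) for p < q.  The sum over all
landings that defines an insertion factors over the internal vertices, and so
[insertE] writes the insertion at i of G2 into G1 as a product of one such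
morphism applied to G1 and one applied to G2.  Hence, on three boundary
vertices,

   b^i o b^j = (e_02 + e_12)^i e_01^j - (e_01 + e_02)^i e_12^j

([circ_b1X]).  On homogeneous elements of degree n, sigma is 1 / (2 (2^n - 2))
times the alternating sum of the mergers, which are algebra morphisms too
([sigma_homog]).  The first merger kills e_01 and sends e_02 and e_12 to b; the
second kills e_12 and sends e_01 and e_02 to b.  For i, j > 0 this leaves
exactly one summand of b^i o b^j under each merger, with value - b^(i+j) for the
first and b^(i+j) for the second, so that the alternating sum of the mergers of
b^i o b^j is - 2 b^(i+j) and that of the bracket of b^i and b^j is
- 4 b^(i+j).

Consequently, if m_i = b^i / i! for all i < n, then sigma (D_n) is
1 / (2^n - 2) times the sum of 1 / (i! j!) over i, j > 0 with i + j = n, times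
b^n.  By the binomial theorem that sum is (2^n - 2) / n! ([sum_inv_fact]), and
the statement follows by strong induction on n.  Characteristic zero makes n!, 2
and 2^n - 2 invertible for n >= 2. *)

(** * The generators *)

Lemma e_lt (k : fieldType) (m : nat) (p q : 'I_m) (lt_pq : (p < q)%N) :
  e k p q = << ucm (@Pair m (p, q) lt_pq : pairs m) >>.
Proof.
rewrite /e; case: insubP => [x _ eq_x|]; last by rewrite lt_pq.
by congr << ucm _ >>; apply: val_inj.
Qed.

Lemma e_diag (k : fieldType) (m : nat) (p : 'I_m) : e k p p = 0.
Proof. by rewrite /e insubN ?ltnn. Qed.

(** * Algebra morphisms defined on graphs *)

Section GraphSubst.
Variables (k : fieldType) (m : nat) (A : comAlgType k).
Variable f : 'I_m * 'I_m -> A.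

(** The product of [f] over the internal vertices of the representative graph of
    the monomial [a]. *)
Definition monom_subst (a : cmonom (pairs m)) : A :=
  \prod_(v <- graph_of_monom a) f v.

(** The linear extension of the same product.  Nothing is asked of [f] on the
    pairs (p, q) with q <= p, which do not occur in representative graphs; the
    result is therefore always the algebra morphism sending e_pq to [f (p, q)]
    for p < q. *)
Definition graph_subst (G : C k m) : A :=
  linext (fun g => \prod_(v <- g) f v) G.

Lemma monom_substE a : monom_subst a = \prod_(x : pairs m) f (val x) ^+ a x.
Proof.
rewrite /monom_subst /graph_of_monom big_map big_flatten big_map big_enum /=.
by apply: eq_bigr => x _; rewrite big_nseq -Monoid.iteropE.
Qed.

Lemma monom_subst_mmorphism : mmorphism (monom_subst : _ -> A).
Proof.
split=> [a b|]; rewrite !monom_substE; last first.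
  by apply: big1 => x _; rewrite cm1 expr0.
by rewrite -big_split; apply: eq_bigr => x _; rewrite cmM exprD.
Qed.

HB.instance Definition _ :=
  monalg.isMultiplicative.Build _ A monom_subst monom_subst_mmorphism.

Lemma graph_substE G : graph_subst G = mmap (in_alg A) monom_subst G.
Proof. by apply: eq_bigr => a _; rewrite mulr_algl. Qed.

Lemma graph_subst_is_additive : additive graph_subst.
Proof. by move=> G H; rewrite !graph_substE raddfB. Qed.

HB.instance Definition _ :=
  GRing.isAdditive.Build (C k m) A graph_subst graph_subst_is_additive.

Lemma graph_subst_is_multiplicative : multiplicative graph_subst.
Proof. by split=> [G H|]; rewrite !graph_substE ?rmorphM ?rmorph1. Qed.

HB.instance Definition _ :=
  GRing.isMultiplicative.Build (C k m) A graph_subst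
    graph_subst_is_multiplicative.

Lemma graph_subst_is_scalable : scalable graph_subst.
Proof. by move=> c G; rewrite !graph_substE mmapZ mulr_algl. Qed.

HB.instance Definition _ :=
  GRing.isScalable.Build k (C k m) A *:%R graph_subst graph_subst_is_scalable.

Lemma graph_subst_e (p q : 'I_m) : (p < q)%N ->
  graph_subst (e k p q) = f (p, q).
Proof.
move=> lt_pq; rewrite e_lt graph_substE mmapU /= scale1r mul1r monom_substE.
rewrite (bigD1 (@Pair m (p, q) lt_pq)) //= cmUU expr1 big1 ?mulr1 // => x.
by rewrite cmU eq_sym => /negPf->; rewrite expr0.
Qed.

End GraphSubst.

(** * Homogeneous elements *)

Section Homogeneous.
Variables (k : fieldType) (m : nat).

(** All monomials of [G] have [n] internal vertices; 0 is homogeneous of every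
    degree. *)
Definition homog (n : nat) (G : C k m) : Prop :=
  forall a, a \in msupp G -> mdeg a = n.

Lemma size_graph_of_monom (a : cmonom (pairs m)) :
  size (graph_of_monom a) = mdeg a.
Proof.
rewrite /graph_of_monom size_map size_flatten /shape -map_comp sumnE big_map.
rewrite big_enum /=; under eq_bigr do rewrite size_nseq.
rewrite mdegE [RHS]big_uniq ?fset_uniq //= [RHS]big_mkcond /=.
by apply: eq_bigr => x _; case: ifPn; rewrite // -cmE_eq0 => /eqP.
Qed.

Lemma homog1 : homog 0 1.
Proof.
move=> a; rewrite -mcoeff_neq0 mcoeff1.
by case: (a =P mone) => [-> _|_ /eqP//]; rewrite mdeg1.
Qed.

Lemma homog0 n : homog n 0.
Proof. by move=> a; rewrite msupp0 inE. Qed.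

Lemma homogD n G H : homog n G -> homog n H -> homog n (G + H).
Proof.
move=> hG hH a /(fsubsetP (msuppD_le _ _)).
by rewrite inE => /orP[/hG | /hH].
Qed.

Lemma homogZ n c G : homog n G -> homog n (c *: G).
Proof. by move=> hG a /(fsubsetP (msuppZ_le _ _))/hG. Qed.

Lemma homog_sum n (I : Type) (r : seq I) (P : pred I) (F : I -> C k m) :
  (forall i, P i -> homog n (F i)) -> homog n (\sum_(i <- r | P i) F i).
Proof. by move=> hF; apply: big_ind; [apply: homog0 | apply: homogD | ]. Qed.

Lemma homogM n1 n2 G H : homog n1 G -> homog n2 H -> homog (n1 + n2) (G * H).
Proof.
by move=> hG hH a /msuppM_le[a1 [a2 [/hG <- /hH <- ->]]]; rewrite mdegM.
Qed.

Lemma homogX n G : homog 1 G -> homog n (G ^+ n).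
Proof.
move=> hG; elim: n => [|n IHn]; first exact: homog1.
by rewrite exprS -add1n; apply: homogM.
Qed.

Lemma homog_e (p q : 'I_m) : (p < q)%N -> homog 1 (e k p q).
Proof.
move=> lt_pq a; rewrite e_lt -mcoeff_neq0 mcoeffU1.
by case: (_ =P a) => [<- _|_ /eqP//]; rewrite mdegU.
Qed.

End Homogeneous.

(** * Insertion as a product of two algebra morphisms *)

Section Insertion.
Variables (k : fieldType) (m1 m2 : nat) (i : 'I_m1).

(** The sum over all ways to land the two edges of a vertex [v] of the outer
    graph. *)
Definition land_vertex (v : 'I_m1 * 'I_m1) : C k (m1 + m2).-1 :=
  \sum_(w | lands i v.1 w.1 && lands i v.2 w.2) e k w.1 w.2.

(** A vertex [v] of the inserted graph, after renumbering. *)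
Definition shift_vertex (v : 'I_m2 * 'I_m2) : C k (m1 + m2).-1 :=
  e k (insert_vertex i v.1) (insert_vertex i v.2).

Lemma graph_insertE (g1 : graph m1) (g2 : graph m2) :
  graph_insert k i g1 g2 =
    (\prod_(v <- g1) land_vertex v) * (\prod_(v <- g2) shift_vertex v).
Proof.
rewrite /graph_insert /graph_class.
under [LHS]eq_bigr do rewrite big_cat big_map /=.
rewrite -big_distrl /=; congr (_ * _).
(* A landing of the edges of g1 is one landing for each vertex of g1: peeling
   off the first vertex splits the sum over tuples into a product of two
   sums. *)
elim: g1 => [|v g IHg].
  by rewrite big_nil (big_pred1 [tuple]) ?big_nil // => h; rewrite [h]tuple0.
rewrite big_cons -IHg big_distrlr /= pair_big.
rewrite (reindex (fun p : _ * (size g).-tuple _ => [tuple of p.1 :: p.2])) /=.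
  by apply: eq_bigr => p _; rewrite big_cons.
exists (fun h : (size g).+1.-tuple _ =>
  (thead h, [tuple of behead h])) => /= h _.
  by case: h => w h; congr (_, _); apply: val_inj.
by rewrite -tuple_eta.
Qed.

Lemma insertE (G1 : C k m1) (G2 : C k m2) :
  insert i G1 G2 = graph_subst land_vertex G1 * graph_subst shift_vertex G2.
Proof.
rewrite /insert /graph_subst /linext big_distrl; apply: eq_bigr => a _ /=.
rewrite -scalerAl big_distrr /=; congr (_ *: _); apply: eq_bigr => b _.
by rewrite -scalerAr graph_insertE.
Qed.

End Insertion.

Lemma scalerCC (k : comNzRingType) (V : lmodType k) (a c : k) (v : V) :
  a *: (c *: v) = c *: (a *: v).
Proof. by rewrite !scalerA mulrC. Qed.

Lemma insertZ (k : fieldType) m1 m2 (i : 'I_m1) c d (G : C k m1) (H : C k m2) :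
  insert i (c *: G) (d *: H) = (c * d) *: insert i G H.
Proof. by rewrite 2!insertE 2!linearZ -scalerAl -scalerAr scalerA. Qed.

Lemma circZ (k : fieldType) m1 m2 c d (G : C k m1) (H : C k m2) :
  circ (c *: G) (d *: H) = (c * d) *: circ G H.
Proof.
rewrite /circ scaler_sumr; apply: eq_bigr => i _.
by rewrite insertZ scalerCC.
Qed.

Lemma insert_eX (k : fieldType) m1 m2 (i : 'I_m1) (p q : 'I_m1) (r s : 'I_m2)
    a c : (p < q)%N -> (r < s)%N ->
  insert i (e k p q ^+ a) (e k r s ^+ c) =
    land_vertex k m2 i (p, q) ^+ a *
    e k (insert_vertex i r) (insert_vertex i s) ^+ c.
Proof. by move=> ? ?; rewrite insertE 2!rmorphXn /= 2?graph_subst_e. Qed.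

(** * Merging boundary vertices *)

(** Here [s] and [c] do not depend on the graph; it is enough that [F0] has the
    stated form on the representatives of the monomials of [G].  The normalizing
    factor of sigma depends on the degree, which is why homogeneity is needed to
    pull it out. *)
Lemma linext_comb (k : fieldType) (m : nat) (V : lmodType k) (I : finType)
    (F0 : graph m -> V) (F : I -> graph m -> V) (s : k) (c : I -> k)
    (G : C k m) :
    (forall a, a \in msupp G ->
       F0 (graph_of_monom a) = s *: \sum_i c i *: F i (graph_of_monom a)) ->
  linext F0 G = s *: \sum_i c i *: linext (F i) G.
Proof.
move=> F0E; rewrite /linext.
under [X in _ = _ *: X]eq_bigr do rewrite scaler_sumr.
rewrite exchange_big scaler_sumr; apply: eq_big_seq => a /F0E->.
rewrite !scaler_sumr; apply: eq_bigr => i _; rewrite !scalerA.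
by congr (_ *: _); ring.
Qed.

Section Merger.
Variables (k : fieldType) (m : nat).

(** The merger of the boundary vertices [i] and [i + 1], as an algebra
    morphism. *)
Definition merge (i : 'I_m.-1) : C k m -> C k m.-1 :=
  graph_subst (fun v => e k (merge_vertex i v.1) (merge_vertex i v.2)).

HB.instance Definition _ i := GRing.LRMorphism.on (merge i).

Lemma merge_e i (p q : 'I_m) : (p < q)%N ->
  merge i (e k p q) = e k (merge_vertex i p) (merge_vertex i q).
Proof. exact: graph_subst_e. Qed.

(** The alternating sum of all mergers, that is sigma without its normalizing
    factor. *)
Definition merge_sum (G : C k m) : C k m.-1 :=
  \sum_(i < m.-1) (-1) ^+ i *: merge i G.

Lemma merge_sum_is_linear : linear merge_sum.
Proof.
move=> c G H; rewrite /merge_sum scaler_sumr -big_split; apply: eq_bigr => i _.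
by rewrite linearP scalerDr !scalerA mulrC.
Qed.

HB.instance Definition _ :=
  GRing.isLinear.Build k (C k m) (C k m.-1) *:%R merge_sum merge_sum_is_linear.

Lemma sigma_homog n (G : C k m) : homog n G ->
  sigma G = (2 * (2 ^+ n - 2))^-1 *: merge_sum G.
Proof.
move=> hG; apply: (linext_comb (c := fun i : 'I_m.-1 => (-1) ^+ i)
  (F := fun i g =>
     \prod_(v <- g) e k (merge_vertex i v.1) (merge_vertex i v.2))) => a /hG <-.
rewrite /graph_sigma size_graph_of_monom.
apply: (congr1 (GRing.scale _)); apply: eq_bigr => i _.
apply: (congr1 (GRing.scale _)).
by rewrite /graph_merge /graph_class big_map.
Qed.

End Merger.

(** * Landings of the edges of e_01 on three vertices *)

Section TwoIntoTwo.
Variables (V : nmodType) (F : 'I_3 -> 'I_3 -> V).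

Lemma sum_lands_prod (i p q : 'I_2) :
  \sum_(w | lands (m2 := 2) i p w.1 && lands (m2 := 2) i q w.2) F w.1 w.2 =
  \sum_(u : 'I_3 | lands (m2 := 2) i p u)
    \sum_(w : 'I_3 | lands (m2 := 2) i q w) F u w.
Proof. by rewrite pair_big_dep. Qed.

(** Inserting at vertex 0: an edge to 0 lands on 0 or 1, and vertex 1 becomes
    vertex 2. *)
Lemma sum_lands0 :
  \sum_(w | lands (m2 := 2) (ord0 : 'I_2) ord0 w.1 &&
            lands (m2 := 2) (ord0 : 'I_2) ord_max w.2) F w.1 w.2 =
  F ord0 ord_max + F (lift ord0 ord0) ord_max.
Proof.
rewrite sum_lands_prod.
rewrite [LHS]big_mkcond /= 2!big_ord_recl big_ord1 /= addr0.
by congr (_ + _); apply: big_pred1.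
Qed.

(** Inserting at vertex 1: an edge to 0 stays there, and an edge to 1 lands on 1
    or 2. *)
Lemma sum_lands1 :
  \sum_(w | lands (m2 := 2) (ord_max : 'I_2) ord0 w.1 &&
            lands (m2 := 2) (ord_max : 'I_2) ord_max w.2) F w.1 w.2 =
  F ord0 (lift ord0 ord0) + F ord0 ord_max.
Proof.
rewrite sum_lands_prod (big_pred1 ord0) //=.
rewrite [LHS]big_mkcond /= 2!big_ord_recl big_ord1 /= add0r.
by congr (F _ _ + F _ _); apply: val_inj.
Qed.

End TwoIntoTwo.

(** * Brackets of powers of b1 and their mergers *)

Lemma castC_id (k : fieldType) (m : nat) (eq_m : m = m) (G : C k m) :
  castC eq_m G = G.
Proof. by rewrite (eq_irrelevance eq_m (erefl m)). Qed.

(** The shape shared by all the compositions b^a o b^c, under a morphism. *)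
Lemma rmorph_mixed (R S : comNzRingType) (f : {rmorphism R -> S}) x y z a c :
  f ((y + z) ^+ a * x ^+ c - (x + y) ^+ a * z ^+ c) =
  (f y + f z) ^+ a * f x ^+ c - (f x + f y) ^+ a * f z ^+ c.
Proof. by rewrite rmorphB !rmorphM !rmorphXn !rmorphD. Qed.

(** The values after the first merger, which in
    [rmorph_mixed] kills [x] and sends [y] and [z] to [t]. *)
Lemma collapse0 (R : comNzRingType) (t : R) a c : (0 < c)%N ->
  (t + t) ^+ a * 0 ^+ c - (0 + t) ^+ a * t ^+ c = - t ^+ (a + c).
Proof. by move=> /gtn_eqF c0; rewrite expr0n c0 mulr0 sub0r add0r exprD. Qed.

(** The values after the second merger, which in
    [rmorph_mixed] kills [z] and sends [x] and [y] to [t]. *)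
Lemma collapse1 (R : comNzRingType) (t : R) a c : (0 < c)%N ->
  (t + 0) ^+ a * t ^+ c - (t + t) ^+ a * 0 ^+ c = t ^+ (a + c).
Proof. by move=> /gtn_eqF c0; rewrite expr0n c0 mulr0 subr0 addr0 exprD. Qed.

Section Constant.
Variable k : fieldType.

(* [b] lies in [C k 2], the others in [C k 3]; [lift ord0 ord0] is vertex 1. *)
Local Notation b := (b1 k).
Local Notation e01 := (e k (ord0 : 'I_3) (lift ord0 ord0)).
Local Notation e02 := (e k (ord0 : 'I_3) ord_max).
Local Notation e12 := (e k (lift ord0 ord0 : 'I_3) ord_max).

Lemma circ22 (G H : C k 2) :
  circ G H = insert (ord0 : 'I_2) G H - insert (ord_max : 'I_2) G H.
Proof.
rewrite /circ big_ord_recl big_ord1 mul0n mul1n expr0 expr1.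
rewrite scale1r scaleN1r.
suff -> : lift ord0 ord0 = ord_max :> 'I_2 by [].
exact: val_inj.
Qed.

Lemma insert0_b1X a c :
  insert (ord0 : 'I_2) (b ^+ a) (b ^+ c) = (e02 + e12) ^+ a * e01 ^+ c.
Proof.
rewrite (@insert_eX k 2 2 ord0 ord0 ord_max ord0 ord_max a c isT isT).
have -> : land_vertex k 2 (ord0 : 'I_2) (ord0, ord_max) = e02 + e12.
  exact: sum_lands0.
have -> : insert_vertex (ord0 : 'I_2) (ord0 : 'I_2) = ord0 by apply: val_inj.
suff -> : insert_vertex (ord0 : 'I_2) (ord_max : 'I_2) = lift ord0 ord0 by [].
exact: val_inj.
Qed.

Lemma insert1_b1X a c :
  insert (ord_max : 'I_2) (b ^+ a) (b ^+ c) = (e01 + e02) ^+ a * e12 ^+ c.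
Proof.
rewrite (@insert_eX k 2 2 ord_max ord0 ord_max ord0 ord_max a c isT isT).
have -> : land_vertex k 2 (ord_max : 'I_2) (ord0, ord_max) = e01 + e02.
  exact: sum_lands1.
have -> : insert_vertex (ord_max : 'I_2) (ord0 : 'I_2) = lift ord0 ord0.
  exact: val_inj.
suff -> : insert_vertex (ord_max : 'I_2) (ord_max : 'I_2) = ord_max by [].
exact: val_inj.
Qed.

Lemma circ_b1X a c :
  circ (b ^+ a) (b ^+ c) =
    (e02 + e12) ^+ a * e01 ^+ c - (e01 + e02) ^+ a * e12 ^+ c.
Proof. by rewrite circ22 insert0_b1X insert1_b1X. Qed.

Lemma homog_circ_b1X a c : homog (a + c) (circ (b ^+ a) (b ^+ c)).
Proof.
rewrite circ_b1X -scaleN1r.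
by apply: homogD; first apply: homogM; last apply/homogZ/homogM;
  apply: homogX; try apply: homogD; apply: homog_e.
Qed.

(** The first merger identifies the vertices 0 and 1. *)
Lemma merge0_e :
  [/\ @merge k 3 ord0 e01 = 0, @merge k 3 ord0 e02 = b
    & @merge k 3 ord0 e12 = b].
Proof.
have v0 : @merge_vertex 3 ord0 (ord0 : 'I_3) = ord0 by apply: val_inj.
have v1 : @merge_vertex 3 ord0 (lift ord0 ord0 : 'I_3) = ord0.
  exact: val_inj.
have v2 : @merge_vertex 3 ord0 (ord_max : 'I_3) = ord_max.
  exact: val_inj.
by rewrite 3?merge_e // v0 v1 v2 e_diag.
Qed.

(** The second merger identifies the vertices 1 and 2. *)
Lemma merge1_e :
  [/\ @merge k 3 ord_max e01 = b, @merge k 3 ord_max e02 = b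
    & @merge k 3 ord_max e12 = 0].
Proof.
have v0 : @merge_vertex 3 ord_max (ord0 : 'I_3) = ord0 by apply: val_inj.
have v1 : @merge_vertex 3 ord_max (lift ord0 ord0 : 'I_3) = ord_max.
  exact: val_inj.
have v2 : @merge_vertex 3 ord_max (ord_max : 'I_3) = ord_max.
  exact: val_inj.
by rewrite 3?merge_e // v0 v1 v2 e_diag.
Qed.

Lemma merge_mixed (i : 'I_2) (x y z : C k 3) a c :
  @merge k 3 i ((y + z) ^+ a * x ^+ c - (x + y) ^+ a * z ^+ c) =
    (@merge k 3 i y + @merge k 3 i z) ^+ a * @merge k 3 i x ^+ c -
    (@merge k 3 i x + @merge k 3 i y) ^+ a * @merge k 3 i z ^+ c.
Proof. exact: rmorph_mixed. Qed.

Lemma merge_circ_b1X (i : 'I_2) a c :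
  @merge k 3 i (circ (b ^+ a) (b ^+ c)) =
    (@merge k 3 i e02 + @merge k 3 i e12) ^+ a * @merge k 3 i e01 ^+ c -
    (@merge k 3 i e01 + @merge k 3 i e02) ^+ a * @merge k 3 i e12 ^+ c.
Proof. by apply: etrans (congr1 _ (circ_b1X a c)) _; apply: merge_mixed. Qed.

Lemma merge0_circ_b1X a c : (0 < c)%N ->
  @merge k 3 ord0 (circ (b ^+ a) (b ^+ c)) = - b ^+ (a + c).
Proof.
move=> c_gt0; have [m01 m02 m12] := merge0_e.
by rewrite merge_circ_b1X m01 m02 m12; apply: collapse0.
Qed.

Lemma merge1_circ_b1X a c : (0 < c)%N ->
  @merge k 3 ord_max (circ (b ^+ a) (b ^+ c)) = b ^+ (a + c).
Proof.
move=> c_gt0; have [m01 m02 m12] := merge1_e.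
by rewrite merge_circ_b1X m01 m02 m12; apply: collapse1.
Qed.

Lemma merge_sum_circ_b1X a c : (0 < c)%N ->
  @merge_sum k 3 (circ (b ^+ a) (b ^+ c)) = - 2 *: b ^+ (a + c).
Proof.
move=> c_gt0; rewrite /merge_sum big_ord_recl big_ord1.
have -> : lift ord0 ord0 = ord_max :> 'I_2 by apply: val_inj.
rewrite merge0_circ_b1X // merge1_circ_b1X //.
rewrite expr0 expr1 scale1r scaleN1r.
by rewrite scaleNr scaler_nat mulr2n opprD.
Qed.

Lemma bracket22 (G H : C k 2) : bracket G H = circ G H + circ H G.
Proof.
rewrite /bracket castC_id.
have -> : (-1) ^+ (2.-1 * 2.-1) = -1 :> k by exact: expr1.
by rewrite scaleN1r opprK.
Qed.

Lemma bracketZ c d (G H : C k 2) :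
  bracket (c *: G) (d *: H) = (c * d) *: (circ G H + circ H G).
Proof.
have GH := circZ c d G H; have HG := circZ d c H G.
rewrite mulrC in HG; rewrite bracket22 scalerDr.
exact: (congr2 +%R GH HG).
Qed.

Lemma homog_bracket_b1X c1 c2 i j :
  @homog k 3 (i + j) (bracket (c1 *: b ^+ i) (c2 *: b ^+ j)).
Proof.
rewrite bracketZ; apply/homogZ/homogD; first exact: homog_circ_b1X.
by rewrite addnC; apply: homog_circ_b1X.
Qed.

Lemma merge_sumZD c (G H : C k 3) :
  merge_sum (c *: (G + H)) = c *: (merge_sum G + merge_sum H).
Proof. by rewrite linearZ linearD. Qed.

Lemma merge_sum_bracket_b1X c1 c2 i j : (0 < i)%N -> (0 < j)%N ->
  @merge_sum k 3 (bracket (c1 *: b ^+ i) (c2 *: b ^+ j)) =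
    (- 4 * (c1 * c2)) *: b ^+ (i + j).
Proof.
move=> i_gt0 j_gt0; rewrite bracketZ.
have Eij := merge_sum_circ_b1X i j_gt0; have Eji := merge_sum_circ_b1X j i_gt0.
rewrite addnC in Eji.
apply: etrans (merge_sumZD _ _ _) _.
apply: etrans (congr1 _ (congr2 +%R Eij Eji)) _.
rewrite -scalerDl scalerA; apply: (congr1 (GRing.scale^~ _)); ring.
Qed.

Lemma scale_sum2 (V : lmodType k) n (P : 'I_n -> pred 'I_n)
    (c : 'I_n -> 'I_n -> k) (s : k) (v : V) :
  \sum_(i < n) \sum_(j < n | P i j) (s * c i j) *: v =
  (s * \sum_(i < n) \sum_(j < n | P i j) c i j) *: v.
Proof.
rewrite mulr_sumr scaler_suml; apply: eq_bigr => i _.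
by rewrite mulr_sumr scaler_suml.
Qed.

Lemma homog_D (c : nat -> k) n : homog n (D (fun i => c i *: b ^+ i) n).
Proof.
apply: homogZ; apply: homog_sum => i _.
apply: homog_sum => j /and3P[_ _ /eqP eq_n].
by have := @homog_bracket_b1X (c i) (c j) i j; rewrite eq_n.
Qed.

(** The factor - 4 is that of [merge_sum_bracket_b1X], and - 1/2 that of [D]. *)
Lemma merge_sum_D (c : nat -> k) n :
  merge_sum (D (fun i => c i *: b ^+ i) n) =
    (- 2^-1 * (- 4 * \sum_(i < n.+1) \sum_(j < n.+1 |
       [&& 0 < i, 0 < j & i + j == n]%N) c i * c j)) *: b ^+ n.
Proof.
rewrite /D linearZ linear_sum -scalerA; apply: (congr1 (GRing.scale _)).
rewrite -scale_sum2; apply: eq_bigr => i _; rewrite linear_sum.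
apply: eq_bigr => j /and3P[i_gt0 j_gt0 /eqP eq_n].
by have := merge_sum_bracket_b1X (c i) (c j) i_gt0 j_gt0; rewrite eq_n.
Qed.

Lemma sigma_D (c : nat -> k) n :
  sigma (D (fun i => c i *: b ^+ i) n) =
    ((2 * (2 ^+ n - 2))^-1 * (- 2^-1 * (- 4 * \sum_(i < n.+1) \sum_(j < n.+1 |
       [&& 0 < i, 0 < j & i + j == n]%N) c i * c j))) *: b ^+ n.
Proof.
have sig := sigma_homog (@homog_D c n).
have mrg := congr1 (GRing.scale (2 * (2 ^+ n - 2))^-1) (merge_sum_D c n).
apply: (etrans sig); apply: (etrans mrg).
exact: scalerA.
Qed.

End Constant.

(** * Sums of inverse factorials *)

Section Factorials.
Variables (k : fieldType) (char_k : [pchar k] =i pred0).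

Lemma natr_neq0 n : (0 < n)%N -> n%:R != 0 :> k.
Proof. by move/pcharf0P: char_k => ->; rewrite lt0n. Qed.

Lemma inv_fact_bin n i : (i <= n)%N ->
  (i`!%:R : k)^-1 * ((n - i)`!%:R)^-1 = 'C(n, i)%:R / n`!%:R.
Proof.
move=> le_in; rewrite -(bin_fact le_in) !natrM.
by field; rewrite !natr_neq0 ?fact_gt0 ?bin_gt0.
Qed.

(** Up to the factor [n`!] this is the binomial expansion of [(1 + 1) ^ n]
    without its two extreme terms. *)
Lemma sum_inv_fact n : (2 <= n)%N ->
  \sum_(i < n.+1) \sum_(j < n.+1 | [&& 0 < i, 0 < j & i + j == n]%N)
    (i`!%:R : k)^-1 * (j`!%:R)^-1 = (2 ^+ n - 2) / n`!%:R.
Proof.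
case: n => [|n] // _.
have -> : 2 ^+ n.+1 - 2 = \sum_(i < n) 'C(n.+1, i.+1)%:R :> k.
  rewrite -{1}[2]/(1 + 1) exprDn big_ord_recl big_ord_recr /= bin0 binn.
  rewrite !expr1n mulr1 addrCA addrK.
  by apply: eq_bigr => i _; rewrite !expr1n mulr1.
(* The terms i = 0 and i = n.+1 are empty sums, as j > 0; every other i allows
   exactly one j. *)
rewrite big_ord_recl big_ord_recr big_pred0 //= add0r [X in _ + X]big_pred0.
  rewrite addr0 mulr_suml; apply: eq_bigr => i _.
  have le_in : (i.+1 <= n.+1)%N by rewrite ltnS ltnW.
  have lt_j : (n.+1 - i.+1 < n.+2)%N by rewrite ltnS leq_subr.
  rewrite -inv_fact_bin // (big_pred1 (Ordinal lt_j)) // => j /=.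
  rewrite -val_eqE /=; case: i j {lt_j} le_in => i lt_i [j lt_j] /= le_in.
  apply/andP/eqP; rewrite /bump /=; first by case=> _ /eqP<-; rewrite addKn.
  by move=> ->; rewrite subnKC // subn_gt0.
move=> j; rewrite /bump /=; case: j => -[|j] //= _.
by rewrite add1n addSn eqSS -[X in _ == X]addn0 eqn_add2l.
Qed.

Lemma two_expn_sub2_neq0 n : (2 <= n)%N -> 2 ^+ n - 2 != 0 :> k.
Proof.
move=> n_ge2; have lt2 : (2 ^ 1 < 2 ^ n)%N by rewrite ltn_exp2l.
by rewrite -natrX -natrB ?natr_neq0 ?subn_gt0 // ltnW.
Qed.

End Factorials.

(** * The recursion *)

Theorem lemma4 (k : fieldType) (char_k : [pchar k] =i pred0)
    (M : nat -> C k 2)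
    (M0 : M 0%N = b0 k) (M1 : M 1%N = b1 k)
    (MS : forall n : nat, (2 <= n)%N -> M n = sigma (D M n)) :
  forall n : nat, M n = (n`!%:R : k)^-1 *: b1 k ^+ n.
Proof.
elim/ltn_ind => -[|[|n]] IHn.
- by rewrite M0 invr1 scale1r.
- by rewrite M1 invr1 scale1r.
set N := n.+2 in IHn *.
(* D M N only involves the terms M i with 0 < i < N, known by induction. *)
have DE : D M N = D (fun i => (i`!%:R : k)^-1 *: b1 k ^+ i) N.
  rewrite /D; apply: (congr1 (GRing.scale _)); apply: eq_bigr => i _.
  apply: eq_bigr => j /and3P[i_gt0 j_gt0 /eqP eq_N].
  have lt_iN : (i < N)%N by rewrite -[X in (_ < X)%N]eq_N -addn1 leq_add2l.
  have lt_jN : (j < N)%N by rewrite -[X in (_ < X)%N]eq_N -add1n leq_add2r.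
  by rewrite (IHn i lt_iN) (IHn j lt_jN).
apply: etrans (MS N isT) _; apply: etrans (congr1 _ DE) _.
apply: etrans (sigma_D _ N) _; apply: (congr1 (GRing.scale^~ _)).
rewrite (sum_inv_fact char_k (isT : (2 <= N)%N)).
have nz := two_expn_sub2_neq0 char_k (isT : (2 <= N)%N).
have nz2 := natr_neq0 char_k (isT : (0 < 2)%N).
have nzf := natr_neq0 char_k (fact_gt0 N).
move: (2 ^+ N - 2) (N`!%:R) nz nzf => u v u0 v0.
by field; rewrite u0 v0 nz2.
Qed.
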